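(* Let $\mathcal{G}=(A,(\preceq_i)_{i\in\mathcal{P}})$ be a game in which each preference relation $\preceq_i$ is an $\omega$-recognizable preorder that is total and prefix-independent. Then a play $\rho=\rho_0\rho_1\dots$ is the outcome of a Nash equilibrium from $\rho_0$ if and only if for every $n$ and every player $i$ with $\rho_n\in V_i$, we have $val_i(\rho_n)\preceq_i[\rho]_i$.
   Context: An arena is $A=(V,E,\mathcal{P},(V_i)_i)$ with finite vertex set $V$, edges $E$ (every vertex has a successor), finite player set $\mathcal{P}$ and partition $(V_i)_i$. A relation on $V^\omega$ is $\omega$-recognizable if it equals $\bigcup_{k}X_k\times Y_k$ with $X_k,Y_k$ $\omega$-regular; a preorder is reflexive and transitive; total if any two words are comparable. A relation $R$ is prefix-independent if for all $x,y\in V^\omega$: $(x,y)\in R\Leftrightarrow\forall u,v\in V^*,(ux,vy)\in R$. Let $x\prec_i y$ iff $x\preceq_i y$ and $y\not\preceq_i x$, and $x\sim_i y$ iff $x\preceq_i y$ and $y\preceq_i x$; $[x]_i$ is the $\sim_i$-class of $x$ (finitely many classes since $\preceq_i$ is $\omega$-recognizable), and classes are ordered by $[x]_i\preceq_i[y]_i$ iff $x\preceq_i y$. Let $\Sigma_i$ be the set of strategies of player $i$ (maps from histories ending in $V_i$ to successors). The value is $val_i(v)=\max_{\sigma_i\in\Sigma_i}\min\{[\pi]_i\mid\pi \text{ a play consistent with }\sigma_i,\ \pi_0=v\}$. A Nash equilibrium from $v_0$ is a profile $\sigma$ with $\langle\sigma\rangle_{v_0}\not\prec_i\langle\tau_i,\sigma_{-i}\rangle_{v_0}$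 for every $i$ and every strategy $\tau_i$ ($\langle\cdot\rangle_{v_0}$ is the outcome). *)

(* Defs.v *)
From mathcomp Require Import all_boot.
Set Implicit Arguments. Unset Strict Implicit. Unset Printing Implicit Defensive.

Definition word (V : Type) := nat -> V.

Definition catw (V : Type) (u : seq V) (x : word V) : word V :=
  fun n => if n < size u then nth (x 0) u n else x (n - size u).

Definition buchi_accepts (V Q : Type) (init : Q -> bool) (delta : Q -> V -> Q -> bool)
  (acc : Q -> bool) (x : word V) : Prop :=
  exists r : nat -> Q, init (r 0) /\ (forall n, delta (r n) (x n) (r n.+1)) /\
    (forall N, exists n, N <= n /\ acc (r n)).

Definition omega_regular (V : finType) (L : word V -> Prop) : Prop :=
  exists (Q : finType) (init : pred Q) (delta : Q -> V -> Q -> bool) (acc : pred Q),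
    forall x, L x <-> buchi_accepts init delta acc x.

Definition omega_recognizable (V : finType) (R : word V -> word V -> Prop) : Prop :=
  exists (K : nat) (X Y : nat -> word V -> Prop),
    (forall k, k < K -> omega_regular (X k) /\ omega_regular (Y k)) /\
    (forall x y, R x y <-> exists k, k < K /\ X k x /\ Y k y).

Definition is_preorder (T : Type) (R : T -> T -> Prop) : Prop :=
  (forall x, R x x) /\ (forall x y z, R x y -> R y z -> R x z).

Definition is_total (T : Type) (R : T -> T -> Prop) : Prop :=
  forall x y, R x y \/ R y x.

Definition prefix_independent (V : Type) (R : word V -> word V -> Prop) : Prop :=
  forall x y, R x y <-> (forall u v : seq V, R (catw u x) (catw v y)).

Definition strict (T : Type) (R : T -> T -> Prop) x y := R x y /\ ~ R y x.
Definition equiv (T : Type) (R : T -> T -> Prop) x y := R x y /\ R y x.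

(* Arena: V finite vertices, E edges, P finite players, owner gives the
   partition (V_i)_i with V_i = [pred v | owner v == i]. *)
Section Games.
Variables (V P : finType) (E : rel V) (owner : V -> P).

(* A strategy of player i maps each history (nonempty sequence of vertices,
   the last one being the current vertex) ending in V_i to a successor. *)
Definition is_strategy (i : P) (s : seq V -> V) : Prop :=
  forall (h : seq V) (v : V), owner v = i -> E v (s (rcons h v)).

Definition is_play (x : word V) : Prop := forall n, E (x n) (x n.+1).

Definition prefix (x : word V) (n : nat) : seq V := mkseq x n.

Definition consistent (i : P) (s : seq V -> V) (v : V) (x : word V) : Prop :=
  x 0 = v /\ is_play x /\
  forall n, owner (x n) = i -> x n.+1 = s (prefix x n.+1).

Definition is_profile (sigma : P -> seq V -> V) : Prop :=
  forall i, is_strategy i (sigma i).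

Fixpoint out_hist (sigma : P -> seq V -> V) (v0 : V) (n : nat) : seq V :=
  match n with
  | 0 => [:: v0]
  | n'.+1 => let h := out_hist sigma v0 n' in
             rcons h (sigma (owner (last v0 h)) h)
  end.

Definition outcome (sigma : P -> seq V -> V) (v0 : V) : word V :=
  fun n => last v0 (out_hist sigma v0 n).

Definition deviate (sigma : P -> seq V -> V) (i : P) (tau : seq V -> V) :
  P -> seq V -> V := fun j => if j == i then tau else sigma j.

Definition nash_eq (pref : P -> word V -> word V -> Prop)
  (sigma : P -> seq V -> V) (v0 : V) : Prop :=
  is_profile sigma /\
  forall i tau, is_strategy i tau ->
    ~ strict (pref i) (outcome sigma v0) (outcome (deviate sigma i tau) v0).

(* [w]_i is the value val_i(v):
   val_i(v) = max_{s} min { [pi]_i | pi consistent with s, pi_0 = v }.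
   The min for strategy s is the class [m]_i of a consistent play m that is
   pref-minimal among consistent plays; the value is the largest such class. *)
Definition min_consistent (le : word V -> word V -> Prop) (i : P)
  (s : seq V -> V) (v : V) (m : word V) : Prop :=
  consistent i s v m /\ forall pi, consistent i s v pi -> le m pi.

Definition is_value (pref : P -> word V -> word V -> Prop) (i : P) (v : V)
  (w : word V) : Prop :=
  (exists s m, is_strategy i s /\ min_consistent (pref i) i s v m /\
               equiv (pref i) m w) /\
  (forall s m, is_strategy i s -> min_consistent (pref i) i s v m -> pref i m w).

End Games.

(* Main.v *)
(** If an outcome gave some player [i], owner of [rho n], less than the value of [rho n], then [i]
would deviate at [rho n] to a value-optimal strategy.  Conversely, if [rho] is worth at least the
value wherever [i] moves, then [i] has no strategy from [rho n] forcing plays strictly better than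
[rho]; by determinacy the other players have a strategy forcing plays no better than [rho], and the
profile "follow [rho], punish the first deviator" is an equilibrium.

Determinacy is Davis' theorem for countable unions of sets "infinitely many prefixes lie in [D]".
Buechi languages have this form without determinization: along an accepting run visiting [s] there
are a position [p] and infinitely many [q] that merge with [p] (from some time on, the factors
starting at [p] and at [q] have the same transition profile) and can be reached from [p] by a loop
on [s] through an accepting state; conversely such loops can be chained into an accepting run. *)
From mathcomp Require Import all_boot.
From mathcomp Require Import boolp.
Require Import Defs.
Set Implicit Arguments. Unset Strict Implicit. Unset Printing Implicit Defensive.

(** * Prefixes of infinite words *)

Section Words.
Variable V : finType.
Implicit Types (x : word V) (h : seq V).

Lemma size_prefix x n : size (prefix x n) = n.
Proof. exact: size_mkseq. Qed.

Lemma take_prefix x m n : m <= n -> take m (prefix x n) = prefix x m.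
Proof. by move=> le_mn; rewrite /prefix /mkseq -map_take take_iota (minn_idPl le_mn). Qed.

Lemma prefixS x n : prefix x n.+1 = rcons (prefix x n) (x n).
Proof. exact: mkseqS. Qed.

End Words.

(** * Davis' determinacy theorem *)

Section Games.
Variable V : finType.
Implicit Types (x : word V) (g h : seq V) (s : seq V -> V).
Implicit Types (mv : seq V -> V -> Prop) (O : word V -> Prop).

Definition legal (own : pred (seq V)) mv s := forall g, own g -> mv g (s g).

(** Moves are constrained from [h] on only, so that a subgame can be restricted afresh at any
    position. *)
Definition play mv h x :=
  prefix x (size h) = h /\ forall n, size h <= n -> mv (prefix x n) (x n).

Definition follows (own : pred (seq V)) s h x :=
  forall n, size h <= n -> own (prefix x n) -> x n = s (prefix x n).

(* Without legality a strategy blocking every play would win vacuously. *)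
Definition winning own mv O s h :=
  legal own mv s /\ forall x, play mv h x -> follows own s h x -> O x.

Definition win own mv O h := exists s, winning own mv O s h.

Lemma play_prefix mv h x k : play mv h x -> size h <= k -> play mv (prefix x k) x.
Proof.
move=> [_ mv_x] le_hk; split; rewrite size_prefix // => n le_kn.
exact: mv_x (leq_trans le_hk le_kn).
Qed.

Lemma follows_prefix own s h x k :
  follows own s h x -> size h <= k -> follows own s (prefix x k) x.
Proof.
move=> fx le_hk n; rewrite size_prefix => le_kn.
exact: fx (leq_trans le_hk le_kn).
Qed.

Variable own : pred (seq V).

(* The strategies [sigma g] are glued by playing at [h] the one attached to the longest prefix of [h]
   satisfying [P] (the empty prefix, if there is none). *)
Lemma paste mv (P : seq V -> Prop) (sigma : seq V -> seq V -> V) :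
  (forall g, legal own mv (sigma g)) ->
  exists2 s, legal own mv s & forall x k, P (prefix x k) ->
    (forall j, k < j -> ~ P (prefix x j)) ->
    follows own s (prefix x k) x -> follows own (sigma (prefix x k)) (prefix x k) x.
Proof.
move=> lsigma.
pose mode h := take (\max_(k < (size h).+1 | `[< P (take k h) >]) k) h.
exists (fun h => sigma (mode h) h); first by move=> g; exact: lsigma.
move=> x k Pk Pj fx n le_kn on; rewrite (fx n le_kn on) /mode.
rewrite !size_prefix in le_kn *.
suff -> : \max_(j < n.+1 | `[< P (take j (prefix x n)) >]) j = k by rewrite take_prefix.
apply/anti_leq/andP; split.
  apply/bigmax_leqP => -[j] /=; rewrite ltnS => le_jn; rewrite take_prefix // => /asboolP Pxj.
  by rewrite leqNgt; apply/negP => /Pj.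
have lt_kn : k < n.+1 by [].
apply: (leq_bigmax_cond (Ordinal lt_kn)) => /=.
by apply/asboolP; rewrite take_prefix.
Qed.

Lemma least_nat (P : nat -> Prop) :
  (exists n, P n) -> exists2 n, P n & forall m, m < n -> ~ P m.
Proof.
move=> exP; have ex : exists n, `[< P n >] by case: exP => n Pn; exists n; apply/asboolP.
case: (ex_minnP ex) => n /asboolP Pn min_n; exists n => // m lt_mn /asboolP /min_n.
by rewrite leqNgt lt_mn.
Qed.

(** Play [s] until a winning position first occurs, then switch for good to a strategy winning
    there. *)
Lemma win_reach mv O h s : legal own mv s ->
  (forall x, play mv h x -> follows own s h x ->
     O x \/ exists2 k, size h <= k & win own mv O (prefix x k)) ->
  win own mv O h.
Proof.
move=> ls reach; have [//|nwin_h] := pselect (win own mv O h).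
have /choice[sigma sigmaP] : forall g, exists s', legal own mv s' /\
    (win own mv O g -> winning own mv O s' g) /\ (~ win own mv O g -> s' = s).
  by move=> g; have [[s' ws']|nw] := pselect (win own mv O g);
    [exists s'; split; [case: ws'|split=> // -[]; exists s'] | exists s].
(* Only the first winning position triggers a switch: after infinitely many switches nothing would
   ensure [O]. *)
pose P g := g = h \/ [/\ size h < size g, win own mv O g &
  forall j, size h <= j < size g -> ~ win own mv O (take j g)].
have [S lS SP] := @paste mv P sigma (fun g => proj1 (sigmaP g)).
exists S; split=> // x px fx.
have [exk|nexk] := pselect (exists k, size h <= k /\ win own mv O (prefix x k)).
  have [k [le_hk wk] min_k] := least_nat exk.
  have lt_hk : size h < k.
    rewrite ltn_neqAle le_hk andbT; apply/eqP => eq_hk; apply: nwin_h.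
    by case: px => <- _; rewrite eq_hk.
  apply: (proj2 ((proj1 (proj2 (sigmaP (prefix x k)))) wk)).
    exact: play_prefix px le_hk.
  apply: SP; last exact: follows_prefix fx le_hk.
    right; split; rewrite ?size_prefix // => j /andP[le_hj lt_jk].
    by rewrite take_prefix ?(ltnW lt_jk) // => wj; apply: (min_k j lt_jk).
  move=> j lt_kj [/(congr1 size)|[_ _ /(_ k)]].
    by rewrite size_prefix => eq_jh; rewrite eq_jh ltnNge le_hk in lt_kj.
  by rewrite size_prefix take_prefix ?(ltnW lt_kj) // le_hk lt_kj => /(_ isT).
have eqh : prefix x (size h) = h by case: px.
have [] // := reach x px.
  have := SP x (size h); rewrite eqh (proj2 (proj2 (sigmaP h)) nwin_h); apply=> //.
    by left.
  move=> j lt_hj [/(congr1 size)|[_ wj _]].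
    by rewrite size_prefix => eq_jh; rewrite eq_jh ltnn in lt_hj.
  by apply: nexk; exists j; split=> //; exact: ltnW.
by move=> [k le_hk wk]; case: nexk; exists k.
Qed.

Definition serial mv := forall h, exists v, mv h v.

Lemma legal_strategy mv : serial mv -> exists s, legal own mv s.
Proof. by move=> /choice[s sP]; exists s => g _; exact: sP. Qed.

Lemma play_rcons mv h x : play mv h x -> mv h (x (size h)) /\ prefix x (size h).+1 = rcons h (x (size h)).
Proof. by move=> [e mvx]; have := mvx _ (leqnn _); rewrite prefixS e. Qed.

Lemma win_own mv O h v : serial mv -> own h -> mv h v ->
  win own mv O (rcons h v) -> win own mv O h.
Proof.
move=> /legal_strategy[s ls] oh mvv wv.
pose s' g := if `[< g = h >] then v else s g.
apply: (@win_reach mv O h s') => [g og|x px fx].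
  by rewrite /s'; case: asboolP => [->//|_]; exact: ls.
right; exists (size h).+1; first exact: leqnSn.
have [_ ->] := play_rcons px.
rewrite fx //; case: px => -> _ //.
by rewrite /s'; case: asboolP.
Qed.

Lemma win_other mv O h : serial mv -> ~~ own h ->
  (forall v, mv h v -> win own mv O (rcons h v)) -> win own mv O h.
Proof.
move=> /legal_strategy[s ls] oh wv.
apply: (win_reach ls) => x px fx; right; exists (size h).+1; first exact: leqnSn.
by have [mvx ->] := play_rcons px; exact: wv.
Qed.

(* Only the opponent of [own] gives up moves: these are Davis' quasi-strategies of the opponent. *)
Definition submoves mv' mv := [/\ serial mv', forall h v, mv' h v -> mv h v &
  forall h v, own h -> mv h v -> mv' h v].

Lemma play_sub mv' mv h x : submoves mv' mv -> play mv' h x -> play mv h x.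
Proof. by move=> [_ sub _] [e p]; split=> // n /p; exact: sub. Qed.

Lemma submoves_trans mv1 mv2 mv3 : submoves mv1 mv2 -> submoves mv2 mv3 -> submoves mv1 mv3.
Proof. by move=> [s1 a1 b1] [s2 a2 b2]; split=> // h v; auto. Qed.

Definition infinitely_often (D : seq V -> Prop) x :=
  forall N, exists2 k, N <= k & D (prefix x k).

Section Davis.
Variables (mv : seq V -> V -> Prop) (W : word V -> Prop) (D : seq V -> Prop).
Hypotheses (smv : serial mv) (DW : forall x, infinitely_often D x -> W x).

Definition good h := exists mv', [/\ submoves mv' mv,
  forall x, play mv' h x -> ~ infinitely_often D x & ~ win own mv' W h].

(** The strict bound on [k] forces progress, so that repeated attempts meet [D] infinitely often. *)
Definition reach_bad h x :=
  W x \/ exists2 k, size h < k & D (prefix x k) /\ ~ good (prefix x k).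

(* Otherwise the opponent makes [h] good: avoid the positions winning for [reach_bad h] until the first
   entry into [D], which must happen at a good position, and then use the subgame given by goodness. *)
Lemma win_bad h : ~ good h -> win own mv (reach_bad h) h.
Proof.
move=> ngood; have [//|nwin] := pselect (win own mv (reach_bad h) h); case: ngood.
pose w := win own mv (reach_bad h).
(* Positions already in [w] keep all their moves, so that [mv1] remains serial. *)
pose mv1 g v := mv g v /\ [\/ own g, w g | ~ w (rcons g v)].
have goodq x k : play mv h x -> size h < k -> D (prefix x k) -> ~ w (prefix x k) ->
    good (prefix x k).
  move=> px lt_hk Dk nwk; have [//|ng] := pselect (good (prefix x k)); case: nwk.
  have [s ls] := legal_strategy smv; exists s; split=> // y [ey _] _; right.
  by rewrite size_prefix in ey; exists k => //; rewrite ey.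
have smv1 g : exists v, mv1 g v.
  have [[o|wg]|/not_orP[/negP o nwg]] := pselect (own g \/ w g).
  - by have [v mvv] := smv g; exists v; split=> //; constructor 1.
  - by have [v mvv] := smv g; exists v; split=> //; constructor 2.
  have [//|/forallNP nex] := pselect (exists v, mv1 g v); case: nwg.
  apply: win_other => // v mvv; have [//|nw] := pselect (w (rcons g v)).
  by case: (nex v); split=> //; constructor 3.
have /choice[G GP] : forall q, exists Gq, submoves Gq mv /\ (good q ->
    (forall x, play Gq q x -> ~ infinitely_often D x) /\ ~ win own Gq W q).
  move=> q; have [[mv' [a b c]]|ng] := pselect (good q); first by exists mv'.
  by exists mv; split.
pose entry g k := [/\ size h < k <= size g, D (take k g) &
  forall j, size h < j < k -> ~ D (take j g)].
have entry_uniq g j k : entry g j -> entry g k -> j = k.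
  move=> [/andP[hj jg] Dj mj] [/andP[hk kg] Dk mk].
  by case: (ltngtP j k) => // [jk|kj]; [case: (mk j)|case: (mj k)]; rewrite ?hj ?hk.
pose mv2 g v := (forall k, entry g k -> G (take k g) g v) /\
                ((forall k, ~ entry g k) -> mv1 g v).
have mv2_entry g k v : entry g k -> mv2 g v <-> G (take k g) g v.
  move=> ek; split=> [[+ _]|Gv]; first exact.
  by split=> [j /(entry_uniq _ _ _ ek)<-|/(_ k)].
have mv2_noentry g v : (forall k, ~ entry g k) -> mv2 g v <-> mv1 g v.
  by move=> ne; split=> [[_]|mv1v]; [exact|split=> // k /ne].
have sub2 : submoves mv2 mv.
  split=> g; have [[k ek]|/forallNP ne] := pselect (exists k, entry g k).
  - have [[sG _ _] _] := GP (take k g); have [v Gv] := sG g.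
    by exists v; apply/(mv2_entry _ _ _ ek).
  - by have [v mvv] := smv1 g; exists v; apply/mv2_noentry.
  - by have [[_ sG _] _] := GP (take k g); move=> v /(mv2_entry _ _ _ ek); exact: sG.
  - by move=> v /(mv2_noentry _ _ ne)[].
  - have [[_ _ sG] _] := GP (take k g); move=> v og mvv; apply/(mv2_entry _ _ _ ek).
    exact: sG.
  - by move=> v og mvv; apply/mv2_noentry => //; split=> //; constructor 1.
have entryP x n k : size h < k <= n -> D (prefix x k) ->
    (forall j, size h < j < k -> ~ D (prefix x j)) -> entry (prefix x n) k.
  move=> /andP[hk kn] Dk mk; split; rewrite ?size_prefix ?take_prefix ?hk //.
  move=> j /andP[hj jk]; rewrite take_prefix ?(ltnW (leq_trans jk kn)) //.
  by apply: mk; rewrite hj.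
have noentryP x n : (forall j, size h < j <= n -> ~ D (prefix x j)) ->
    forall k, ~ entry (prefix x n) k.
  move=> nD k [/andP[hk kn]]; rewrite size_prefix in kn; rewrite take_prefix //.
  by move=> Dk _; case: (nD k); rewrite ?hk.
have first_entry x : (exists k, size h < k /\ D (prefix x k)) ->
    exists k, [/\ size h < k, D (prefix x k) & forall j, size h < j < k -> ~ D (prefix x j)].
  by move=> /least_nat[k [hk Dk] mk]; exists k; split=> // j /andP[hj /mk nD] Dj; exact: nD.
exists mv2; split=> //.
- move=> x px2 inf.
  have px := play_sub sub2 px2.
  have [k [hk Dk mk]] : exists k, [/\ size h < k, D (prefix x k) &
      forall j, size h < j < k -> ~ D (prefix x j)].
    by apply: first_entry; have [k hk Dk] := inf (size h).+1; exists k.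
  have nwh : ~ w (prefix x (size h)) by case: px => ->.
  (* Before the first entry into [D] the moves obey [mv1], which never lets the play into [w]. *)
  have nwx j : size h <= j <= k -> ~ w (prefix x j).
    elim: j => [|j IH] /andP[hj jk].
      by move: hj nwh; rewrite leqn0 => /eqP->.
    move: hj; rewrite leq_eqVlt => /orP[/eqP<-//|hj].
    have nwj : ~ w (prefix x j) by apply: IH; rewrite -ltnS hj ltnW.
    case: px2 => _ /(_ j hj)/mv2_noentry[].
      apply: noentryP => i /andP[hi ij]; apply: mk.
      by rewrite hi (leq_ltn_trans ij).
    rewrite prefixS => mvx [o|//|//] wn; apply: nwj; exact: win_own o mvx wn.
  have gk : good (prefix x k) by apply: (goodq x k px hk Dk); apply: nwx; rewrite leqnn ltnW.
  have [_ /(_ gk)[nB _]] := GP (prefix x k).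
  apply: (nB x) => //; split; rewrite size_prefix // => n kn.
  have ek : entry (prefix x n) k by apply: entryP; rewrite ?hk.
  have := (mv2_entry _ _ (x n) ek).1; rewrite take_prefix //; apply.
  by case: px2 => _; apply; exact: ltnW (leq_trans hk kn).
(* A strategy [s] forcing [W] in [mv2] would force [reach_bad h] in [mv]: a play avoiding [w] obeys
   [mv1], hence lies in [W] if it never enters [D], while at an entry [s] would win the subgame
   attached to a good position. *)
move=> [s [ls ws]]; apply: nwin.
have ls0 : legal own mv s by move=> g og; case: sub2 => _ sub _; exact/sub/ls.
apply: (win_reach ls0) => x px fx.
have [exw|nexw] := pselect (exists2 k, size h <= k & w (prefix x k)); first by right.
have nwx k : size h <= k -> ~ w (prefix x k) by move=> hk wk; apply: nexw; exists k.
have mv1x n : size h <= n -> mv1 (prefix x n) (x n).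
  move=> hn; split; first by case: px => _; exact.
  by constructor 3; rewrite -prefixS; apply: nwx; exact: leqW.
left; left.
have [/first_entry[k [hk Dk mk]]|nD] := pselect (exists k, size h < k /\ D (prefix x k)); last first.
  apply: ws => //; split=> [|n hn]; first by case: px.
  apply/mv2_noentry; last exact: mv1x.
  by apply: noentryP => j /andP[hj _] Dj; apply: nD; exists j.
have gk : good (prefix x k) by apply: goodq px hk Dk (nwx _ (ltnW hk)).
have [[_ _ sG] /(_ gk)[_ []]] := GP (prefix x k).
exists s; split=> [g og|y py fy]; first by apply: sG => //; exact: ls0.
have eqy n : n <= k -> prefix y n = prefix x n.
  by move=> nk; case: py => e _; rewrite -(take_prefix x nk) -e size_prefix take_prefix.
have eqyx n : n < k -> y n = x n.
  move=> nk; have := eqy _ nk; rewrite !prefixS => /(congr1 rev).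
  by rewrite !rev_rcons => -[].
apply: ws; last first.
  move=> n hn on; case: (ltnP n k) => nk; last by apply: fy; rewrite ?size_prefix.
  by rewrite eqyx // eqy ?(ltnW nk) //; apply: fx => //; rewrite -eqy // ltnW.
split=> [|n hn]; first by rewrite eqy; [case: px|exact: ltnW].
have [nk|kn] := ltnP n k.
  rewrite eqyx // eqy ?(ltnW nk) //; apply/mv2_noentry; last exact: mv1x.
  by apply: noentryP => j /andP[hj jn]; apply: mk; rewrite hj (leq_ltn_trans jn).
have ek : entry (prefix y n) k.
  apply: entryP; rewrite ?hk ?eqy // => j /andP[hj jk]; rewrite eqy ?(ltnW jk) //.
  by apply: mk; rewrite hj.
apply/(mv2_entry _ _ _ ek); rewrite take_prefix // eqy //.
by case: py => _; apply; rewrite size_prefix.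
Qed.

(* From a bad position one forces [W] or another bad position in [D]; repeating this forever meets [D]
   infinitely often, so [W] is forced in any case. *)
Lemma avoid_Gdelta h : ~ win own mv W h -> good h.
Proof.
move=> nwin; have [//|ngood] := pselect (good h); case: nwin.
have /choice[sigma sigmaP] : forall g, exists s, legal own mv s /\
    (~ good g -> winning own mv (reach_bad g) s g).
  move=> g; have [gg|/win_bad[s ws]] := pselect (good g).
    by have [s ls] := legal_strategy smv; exists s.
  by exists s; split=> //; case: ws.
pose P g := g = h \/ [/\ size h < size g, D g & ~ good g].
have [S lS SP] := @paste mv P sigma (fun g => proj1 (sigmaP g)).
exists S; split=> // x px fx.
(* Infinitely many restarts meet [D] infinitely often. Otherwise the strategy of the last restart
   must yield [W], since its other alternative would be one more restart. *)
have [inf|/existsNP[N /forallNP fin]] :=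
  pselect (forall N, exists k, N <= k /\ P (prefix x k)).
  apply: DW => N; have [k []] := inf (maxn N (size h).+1).
  rewrite geq_max => /andP[Nk hk] [/(congr1 size)|[_ Dk _]]; last by exists k.
  by rewrite size_prefix => e; rewrite e ltnn in hk.
have Ph : P (prefix x (size h)) by left; case: px.
have [k Pk maxk] : exists2 k, P (prefix x k) & forall j, k < j -> ~ P (prefix x j).
  have exP : exists n, `[< P (prefix x n) >] by exists (size h); apply/asboolP.
  have ubP n : `[< P (prefix x n) >] -> n <= N.
    move=> /asboolP Pn; rewrite leqNgt; apply/negP => Nn.
    by apply: (fin n); split=> //; exact: ltnW.
  case: (ex_maxnP exP ubP) => k /asboolP Pk maxk; exists k => // j kj /asboolP/maxk.
  by rewrite leqNgt kj.
have [hk ngk] : size h <= k /\ ~ good (prefix x k).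
  case: Pk => [e|[]]; last by rewrite size_prefix => /ltnW.
  by rewrite e -[k](size_prefix x) e.
have [_ /(_ ngk)[_ ws]] := sigmaP (prefix x k).
have [||//|[j]] := ws x.
- exact: play_prefix px hk.
- by apply: SP => //; exact: follows_prefix fx hk.
rewrite size_prefix => kj [Dj ngj]; case: (maxk j kj); right.
by rewrite size_prefix (leq_ltn_trans hk).
Qed.

End Davis.
End Games.

(** The Borel class $\Sigma^0_3$: the sets of words with infinitely many prefixes in a given set are
    exactly the $G_\delta$ sets. *)
Definition sigma3 (V : finType) (W : word V -> Prop) :=
  exists (I : countType) (D : I -> seq V -> Prop),
    forall x, W x <-> exists i, infinitely_often (D i) x.

(* The opponent shrinks the game once per move: after [n] moves it avoids the [n]-th set of the union
   from there on, while [W] still cannot be forced against it. *)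
Lemma sigma3_determined (V : finType) (own : pred (seq V)) (mv : seq V -> V -> Prop)
    (W : word V -> Prop) (h : seq V) : serial mv -> sigma3 W ->
  win own mv W h \/ win (predC own) mv (fun x => ~ W x) h.
Proof.
move=> smv [I [D WD]]; have [|nwin] := pselect (win own mv W h); [by left | right].
pose B n := if unpickle n is Some i then D i else fun=> False.
have WB x : W x <-> exists n, infinitely_often (B n) x.
  rewrite WD; split=> [[i Di]|[n]]; first by exists (pickle i); rewrite /B pickleK.
  by rewrite /B; case: (unpickle n) => [i Di|/(_ 0)[]//]; exists i.
have /choice[F FP] (a : nat * (seq V -> V -> Prop) * seq V) : exists mv', serial a.1.2 ->
    ~ win own a.1.2 W a.2 -> [/\ submoves own mv' a.1.2,
      forall x, play mv' a.2 x -> ~ infinitely_often (B a.1.1) x & ~ win own mv' W a.2].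
  have [sa|] := pselect (serial a.1.2); last by exists mv.
  have [|nwa] := pselect (win own a.1.2 W a.2); first by exists mv.
  have [|mv' mv'P] := avoid_Gdelta sa _ nwa (D := B a.1.1); last by exists mv'.
  by move=> x Bx; apply/WB; exists a.1.1.
pose k n := size h + n.
(* [M n g] is the subgame in force after [n] moves; it depends only on the first [k n] vertices of
   [g]. *)
pose fix M n g {struct n} := F (n, if n is n'.+1 then M n' g else mv, take (k n) g).
have M_take n g : M n (take (k n) g) = M n g.
  elim: n g => [|n IH] g /=; first by rewrite take_takel.
  by rewrite take_takel // -IH take_takel ?IH // /k addnS.
pose Mx x n := M n (prefix x (k n)).
have MxE x n m : k n <= m -> M n (prefix x m) = Mx x n.
  by move=> le_nm; rewrite -M_take take_prefix.
have MS x n : Mx x n.+1 = F (n.+1, Mx x n, prefix x (k n.+1)).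
  by rewrite {1}/Mx /= take_prefix // MxE // /k addnS.
pose Minv x n := [/\ submoves own (Mx x n) mv,
  forall y, play (Mx x n) (prefix x (k n)) y -> ~ infinitely_often (B n) y &
  ~ win own (Mx x n) W (prefix x (k n))].
(* After [n] moves the opponent moves inside the current subgame to a position where [W] still
   cannot be forced; [win_other] provides such a move. *)
have /choice[t tP] g : exists v, mv g v /\ forall n, size g = k n -> ~~ own g ->
    submoves own (M n g) mv -> ~ win own (M n g) W g ->
    M n g g v /\ ~ win own (M n g) W (rcons g v).
  have [[n [sz ng [sM aM bM] nwg]]|no] := pselect (exists n, [/\ size g = k n, ~~ own g,
      submoves own (M n g) mv & ~ win own (M n g) W g]); last first.
    have [v mvv] := smv g; exists v; split=> // n sz ng sM nwg.
    by case: no; exists n.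
  have [v [Mv nwv]] : exists v, M n g g v /\ ~ win own (M n g) W (rcons g v).
    have [//|/forallNP ex] := pselect (exists v, M n g g v /\ ~ win own (M n g) W (rcons g v)).
    case: nwg; apply: win_other => // v Mv.
    have [//|nw] := pselect (win own (M n g) W (rcons g v)).
    by case: (ex v).
  exists v; split=> [|n']; first exact: aM.
  by rewrite sz => /addnI <-.
exists t; split=> [g _|x px fx Wx]; first by have [] := tP g.
have eh : prefix x (size h) = h by case: px.
have move_x n : Minv x n ->
    Mx x n (prefix x (k n)) (x (k n)) /\ ~ win own (Mx x n) W (prefix x (k n.+1)).
  move=> [sub _ nw]; rewrite /k addnS prefixS -/(k n).
  have [o|o] := boolP (own (prefix x (k n))); last first.
    rewrite fx //; last exact: leq_addr.
    have [_ /(_ n)] := tP (prefix x (k n)).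
    by rewrite size_prefix; apply.
  have [sM _ Mmv] := sub.
  have Mxx : Mx x n (prefix x (k n)) (x (k n)).
    by apply: Mmv => //; case: px => _; apply; exact: leq_addr.
  by split=> // wn; apply: nw; exact: win_own o Mxx wn.
have MinvS n : Minv x n -> submoves own (Mx x n.+1) (Mx x n) /\ Minv x n.+1.
  move=> inv; have [_ nw] := move_x n inv; have [sub _ _] := inv.
  have [|//|] := FP (n.+1, Mx x n, prefix x (k n.+1)); first by case: sub.
  rewrite -MS => sub' avoid' nw'; split=> //; split=> //.
  exact: submoves_trans sub' sub.
have invx n : Minv x n.
  elim: n => [|n /MinvS[]//].
  have M0 : Mx x 0 = F (0, mv, h) by rewrite /Mx /= take_prefix // /k addn0 eh.
  have [] := FP (0, mv, h) => //=.
  by rewrite -M0 /Minv /k addn0 eh.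
have sub_le n j : submoves own (Mx x (n + j)) (Mx x n).
  elim: j => [|j IH]; first by rewrite addn0; split=> //; have [[]] := invx n.
  by rewrite addnS; apply: submoves_trans IH; case: (MinvS _ (invx (n + j))).
(* The subgames are nested, so from time [k n] on [x] is a play of the subgame that excludes
   [B n]. *)
have /WB[n Bn] := Wx.
have [_ /(_ x) nB _] := invx n; apply: nB Bn.
split; rewrite size_prefix // => m le_m.
have [j ->] : exists j, m = k (n + j).
  by exists (m - k n); rewrite /k addnA -/(k n) subnKC.
by have [_ sub _] := sub_le n j; apply: sub; case: (move_x _ (invx (n + j))).
Qed.

(** * Buechi languages *)

(** Otherwise each [p] has a bound [N p] from which on no [q] merges with it; [#|T|.+1] positions
    spaced beyond these bounds would have pairwise distinct colours at the time of the last one. *)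
Lemma io_class (T : finType) (c : nat -> nat -> T) :
  (forall i j k l, i <= k -> j <= k -> k <= l -> c i k = c j k -> c i l = c j l) ->
  exists p, forall N, exists q, [/\ N <= q, p <= q & exists2 k, q <= k & c p k = c q k].
Proof.
move=> cP; apply: contrapT => /forallNP no.
have /choice[N NP] p : exists N, forall q k, N <= q -> p <= q -> q <= k -> c p k <> c q k.
  have /existsNP[N /forallNP noq] := no p; exists N => q k Nq pq qk cpq.
  by apply: (noq q); split=> //; exists k.
pose a n := iter n (fun m => maxn m.+1 (\max_(i < m.+1) N i)) 0.
have a_ltn i j : i < j -> (a i < a j) && (N (a i) <= a j).
  elim: j => // j IH; rewrite ltnS leq_eqVlt => /orP[/eqP->|/IH/andP[aij Nij]] /=.
    rewrite !leq_max leqnn /=; apply/orP; right.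
    exact: (leq_bigmax (Ordinal (ltnSn (a j)))).
  have aj : a j <= a j.+1 by rewrite /= leq_max leqnSn.
  by rewrite (leq_trans Nij aj) (leq_trans aij aj).
have a_leq i j : i <= j -> a i <= a j.
  by rewrite leq_eqVlt => /orP[/eqP->//|/a_ltn/andP[/ltnW]].
pose f (j : 'I_#|T|.+1) := c (a j) (a #|T|).
have ltf (i j : 'I_#|T|.+1) : i < j -> f i <> f j.
  move=> lt_ij; have /andP[aij Nij] := a_ltn _ _ lt_ij.
  by apply: NP => //; [exact: ltnW | exact/a_leq/leq_ord].
have /leq_card : injective f.
  by move=> i j fij; apply/val_inj; case: (ltngtP i j) => // /ltf; rewrite fij.
by rewrite card_ord ltnn.
Qed.

Section Buchi.
Variables (V Q : finType) (init : pred Q) (delta : Q -> V -> Q -> bool) (acc : pred Q).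
Implicit Types (x : word V) (u : seq V) (S : {set Q * Q * bool}).

(** Acceptance is read off the source of each transition: the flag of a factor covers all states of
    the run but the last. *)
Definition profile_step S v : {set Q * Q * bool} :=
  [set t | [exists s, exists b, [&& (t.1.1, s, b) \in S, delta s v t.1.2 &
                                    t.2 == b || acc s]]].

(** The class of [u] in Buechi's congruence, as the set of triples start, end and flag over all runs
    on [u]. *)
Definition profile u := foldl profile_step [set (s, s, false) | s : Q] u.

Definition segment x m n := drop m (prefix x n).

Lemma segmentE x m n : segment x m n = map x (iota m (n - m)).
Proof. by rewrite /segment /prefix /mkseq -map_drop drop_iota. Qed.

Lemma segment_cat x m n k : m <= n -> n <= k -> segment x m k = segment x m n ++ segment x n k.
Proof.
move=> mn nk; rewrite !segmentE -map_cat; congr map.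
rewrite -{2}(subnKC mn) -iotaD; congr iota.
by rewrite addnC addnBA // subnK.
Qed.

Lemma segmentS x m n : m <= n -> segment x m n.+1 = rcons (segment x m n) (x n).
Proof. by move=> mn; rewrite /segment prefixS drop_rcons // size_prefix. Qed.

(** Profiles are left folds, so their equality persists when both factors are extended by the same
    letters. *)
Lemma profile_merge x i j k l : i <= k -> j <= k -> k <= l ->
  profile (segment x i k) = profile (segment x j k) ->
  profile (segment x i l) = profile (segment x j l).
Proof.
move=> ik jk kl e.
by rewrite (segment_cat x ik kl) (segment_cat x jk kl) /profile !foldl_cat -!/(profile _) e.
Qed.

Lemma profile_run x (r : nat -> Q) m n : m <= n ->
  (forall i, m <= i < n -> delta (r i) (x i) (r i.+1)) ->
  (r m, r n, has (acc \o r) (index_iota m n)) \in profile (segment x m n).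
Proof.
move=> mn; rewrite -(subnKC mn); elim: (n - m) => [|d IH] run.
  by rewrite addn0 segmentE /index_iota subnn; apply/imsetP; exists (r m).
rewrite addnS segmentS ?leq_addr // /profile foldl_rcons -/(profile _) inE.
apply/existsP; exists (r (m + d)); apply/existsP.
exists (has (acc \o r) (index_iota m (m + d))); apply/and3P; split.
- by apply: IH => i /andP[mi id]; apply: run; rewrite mi addnS ltnW.
- by apply: run; rewrite leq_addr addnS leqnn.
- by rewrite /= /index_iota subSn ?leq_addr // addKn -addn1 iotaD has_cat /= orbF.
Qed.

Lemma run_profile x s t b m n : m <= n -> (s, t, b) \in profile (segment x m n) ->
  exists r : nat -> Q, [/\ r m = s, r n = t,
    forall i, m <= i < n -> delta (r i) (x i) (r i.+1) &
    b -> exists2 i, m <= i < n & acc (r i)].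
Proof.
move=> mn; rewrite -(subnKC mn); elim: (n - m) t b => [|d IH] t b.
  rewrite addn0 segmentE subnn => /imsetP[q _ [-> -> ->]].
  by exists (fun=> q); split=> // i /andP[mi]; rewrite ltnNge mi.
rewrite addnS segmentS ?leq_addr // /profile foldl_rcons -/(profile _) inE.
move=> /existsP[q /existsP[b' /= /and3P[/IH[r [rm rd run accr]] dq /eqP->]]].
have le_md := leq_addr d m.
exists (fun i => if i <= m + d then r i else t); split=> [|||].
- by rewrite le_md.
- by rewrite ltnn.
- move=> i; rewrite ltnS => /andP[mi]; rewrite leq_eqVlt => /orP[/eqP->|id].
    by rewrite eqxx ltnn /= rd.
  by rewrite id orbT run // mi.
- case/orP => [/accr[i /andP[mi id] ai]|aq]; [exists i|exists (m + d)].
  + by rewrite mi ltnS ltnW.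
  + by rewrite ltnW.
  + by rewrite le_md ltnSn.
  + by rewrite leqnn rd.
Qed.

(** An initial run up to [p] is continued by loops on [s] through an accepting state, spliced at
    successive times in [G]. *)
Lemma accepting_run x p (s0 s : Q) b (G : nat -> Prop) :
  init s0 -> (s0, s, b) \in profile (segment x 0 p) -> G p ->
  (forall m, G m -> exists n, [/\ m < n, G n & (s, s, true) \in profile (segment x m n)]) ->
  buchi_accepts init delta acc x.
Proof.
move=> init0 /(run_profile (leq0n p))[r0 [r00 r0p run0 _]] Gp next.
have /choice[nx nxP] m : exists nr : nat * (nat -> Q), G m ->
    [/\ m < nr.1, G nr.1, nr.2 m = s, nr.2 nr.1 = s &
      (forall i, m <= i < nr.1 -> delta (nr.2 i) (x i) (nr.2 i.+1)) /\
      exists2 i, m <= i < nr.1 & acc (nr.2 i)].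
  have [Gm|nG] := pselect (G m); last by exists (0, fun=> s).
  have [n [mn Gn sn]] := next m Gm.
  have [r [rm rn run /(_ isT) accr]] := run_profile (ltnW mn) sn.
  by exists (n, r).
(* [cur n] is the start of the loop that covers time [n], and is [p] before time [p]. *)
pose fix cur n := if n is n'.+1 then
  if (nx (cur n')).1 == n then n else cur n' else p.
have cur_inv n : G (cur n) /\ n < (nx (cur n)).1.
  elim: n => [|n [Gc nc]] /=; first by split=> //; have [] := nxP p Gp; case: (nx p).1.
  case: eqP => [e|/eqP e].
    have Gn : G n.+1 by rewrite -e; have [] := nxP _ Gc.
    by split=> //; have [] := nxP _ Gn.
  by split=> //; rewrite ltn_neqAle eq_sym e.
have cur_p n : n <= p -> cur n = p.
  elim: n => // n IH np /=; rewrite IH ?(ltnW np) //; case: eqP => // e.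
  by have [] := nxP p Gp; rewrite e ltnNge np.
have cur_le n : p <= n -> cur n <= n.
  elim: n => [|n IH]; first by rewrite leqn0 => /eqP->.
  rewrite leq_eqVlt => /orP[/eqP e|pn]; first by rewrite cur_p ?e.
  by rewrite [cur _]/=; case: eqP => // _; exact: leq_trans (IH pn) (leqnSn n).
have cur_stay m n : m <= n < (nx (cur m)).1 -> cur n = cur m.
  elim: n => [|n IH]; first by rewrite leqn0 => /andP[/eqP->].
  move=> /andP[+ nm]; rewrite leq_eqVlt => /orP[/eqP->//|mn].
  have {IH}e : cur n = cur m by apply: IH; rewrite -ltnS mn (ltnW nm).
  by rewrite [LHS]/= e; case: eqP => // e'; rewrite e' ltnn in nm.
pose r n := if n < p then r0 n else (nx (cur n)).2 n.
have rp n : p <= n -> r n = (nx (cur n)).2 n by rewrite leqNgt /r => /negbTE->.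
exists r; split; [|split].
- rewrite /r; case: ltnP => [p0|]; first by rewrite r00.
  rewrite leqn0 => /eqP p0; have [_ _ + _ _] := nxP p Gp.
  by rewrite /= -r0p p0 r00 => ->.
- move=> n; case: (ltnP n p) => [np|pn].
    have rn : r n = r0 n by rewrite /r np.
    have -> : r n.+1 = r0 n.+1.
      rewrite /r; case: ltnP => // pn; have e : n.+1 = p by apply/anti_leq; rewrite np.
      by rewrite e cur_p // r0p; have [] := nxP p Gp.
    by rewrite rn run0.
  have [Gc cn] := cur_inv n; have [_ _ _ cs [crun _]] := nxP _ Gc.
  have -> : r n.+1 = (nx (cur n)).2 n.+1.
    rewrite rp ?leqW //=; case: eqP => // e.
    have Gn : G n.+1 by rewrite -e; have [] := nxP _ Gc.
    by rewrite e in cs; rewrite cs; have [] := nxP _ Gn.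
  by rewrite rp // crun // cur_le.
(* The loop starting at the first splice point after [m] visits an accepting state, necessarily
   after time [N]. *)
- move=> N; pose m := maxn N p; have [Gm mm] := cur_inv m.
  have [_ Gn _ _ _] := nxP _ Gm; set n := (nx (cur m)).1 in mm Gn.
  have [Nn pn] : N <= n /\ p <= n.
    by move: (ltnW mm); rewrite geq_max => /andP.
  have cn : cur n = n.
    have n0 : 0 < n by exact: leq_ltn_trans mm.
    rewrite -(prednK n0) /= (cur_stay m) ?prednK //; last by rewrite -ltnS prednK ?mm //=.
    by rewrite eqxx.
  have [_ _ _ _ [_ [i /andP[ni iq] ai]]] := nxP _ Gn.
  exists i; split; first exact: leq_trans ni.
  by rewrite rp ?(leq_trans pn) // (cur_stay n) cn // ni.
Qed.

(* [h] is the exact time at which [q] merges with [p], so that infinitely many events give infinitely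
   many [q]. *)
Definition merge_event (ps : nat * Q) (h : seq V) :=
  let: (p, s) := ps in
  (exists s0 b, init s0 /\ (s0, s, b) \in profile (take p h)) /\
  exists q, [/\ p < q < size h, (s, s, true) \in profile (drop p (take q h)),
    profile (drop p h) = profile (drop q h) &
    profile (drop p (take (size h).-1 h)) <> profile (drop q (take (size h).-1 h))].

Lemma buchi_sigma3 : sigma3 (buchi_accepts init delta acc).
Proof.
exists (nat * Q)%type, merge_event => x; split=> [[r [r0 [run accr]]]|[[p s] io]].
  (* With [r i] in the colour, merging positions carry the same state, so the run between them is a
     loop. *)
  have [|p pP] := @io_class (Q * {set Q * Q * bool})%type
      (fun i k => (r i, profile (segment x i k))).
    by move=> i j k l ik jk kl [-> e]; congr pair; exact: profile_merge e.
  exists (p, r p) => N.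
  have [n [pn an]] := accr p.
  have [q [+ _ [k qk [erpq ek]]]] := pP (maxn N n.+1).
  rewrite geq_max => /andP[Nq nq]; have pq : p < q by exact: leq_ltn_trans nq.
  have sq : (r p, r p, true) \in profile (segment x p q).
    have -> : true = has (acc \o r) (index_iota p q).
      by apply/esym/hasP; exists n => //; rewrite mem_index_iota pn.
    rewrite {2}erpq; apply: profile_run => //; exact: ltnW.
  have [|l [ql el] min_l] := @least_nat (fun l => q <= l /\
      profile (segment x p l) = profile (segment x q l)); first by exists k.
  (* At [l = q] the second factor is empty and its profile has no accepting flag, unlike that of the
     loop. *)
  have lt_ql : q < l.
    rewrite ltn_neqAle ql andbT; apply/eqP => eql; move: sq.
    rewrite eql el -eql segmentE subnn => /imsetP[? _ []//].
  have l0 : 0 < l by exact: leq_ltn_trans lt_ql.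
  exists l; first exact: leq_trans Nq ql.
  split.
    rewrite take_prefix ?(leq_trans (ltnW pq)) //.
    exists (r 0), (has (acc \o r) (index_iota 0 p)); split=> //.
    by have := @profile_run x r 0 p; rewrite /segment drop0; apply.
  exists q; rewrite size_prefix pq lt_ql take_prefix // take_prefix ?leq_pred //.
  split=> // e; apply: (min_l l.-1); first by rewrite prednK.
  by split=> //; rewrite -ltnS prednK.
have [s0 [b [init0 s0s]]] : exists s0 b, init s0 /\ (s0, s, b) \in profile (segment x 0 p).
  have [k pk [[s0 [b [i0 +]]] _]] := io p.
  by rewrite take_prefix // => s0s; exists s0, b; rewrite /segment drop0.
pose merged q k := profile (segment x p k) = profile (segment x q k).
have unbounded N : exists q, [/\ N <= q, p < q, (s, s, true) \in profile (segment x p q) &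
    exists2 k, q <= k & merged q k].
  (* From some time [K] on, every [q] between [p] and [N] that ever merges with [p] has already
     merged, so an event beyond [K] must come from a [q] that is at least [N]. *)
  have [K KP] : exists K, forall q k, q < N -> p <= q -> q <= k -> merged q k ->
      forall l, K <= l -> merged q l.
    elim: N => [|N [K KP]]; first by exists 0.
    have [[k [pN Nk mk]]|no] := pselect (exists k, [/\ p <= N, N <= k & merged N k]).
      exists (maxn K k) => q k' + pq qk' mk' l; rewrite geq_max => qN /andP[Kl kl].
      move: qN; rewrite ltnS leq_eqVlt => /orP[/eqP e|qN]; last exact: KP mk' _ Kl.
      by rewrite e; apply: profile_merge mk => //; exact: leq_trans Nk.
    exists K => q k + pq qk mk; rewrite ltnS leq_eqVlt => /orP[/eqP e|qN].
      by case: no; exists k; rewrite -e.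
    exact: KP mk.
  have [k Kk [_ [q []]]] := io K.+1.
  rewrite size_prefix => /andP[pq qk]; rewrite !take_prefix ?leq_pred ?(ltnW qk) //.
  move=> sq mk nmk; exists q; split=> //; last by exists k => //; exact: ltnW.
  rewrite leqNgt; apply/negP => qN; apply: nmk.
  by apply: (KP q k) => //; rewrite ?(ltnW pq) ?(ltnW qk) // -ltnS (ltn_predK qk).
apply: (accepting_run (G := fun q => p <= q /\ exists2 k, q <= k & merged q k) init0 s0s).
  by split=> //; exists p.
move=> m [pm [k mk mm]]; have [q [kq pq sq exk]] := unbounded k.+1.
have mq : m < q by exact: leq_ltn_trans kq.
exists q; split=> //; first by split=> //; exact: ltnW.
(* [m] and [p] have merged before time [q], so the loop from [p] to [q] can be replaced by one from
   [m] to [q]. *)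
by rewrite -(profile_merge _ _ (ltnW kq) mm) //; exact: leq_trans mk.
Qed.

End Buchi.

Lemma sigma3_bigcup (V : finType) (J : countType) (W : J -> word V -> Prop) :
  (forall j, sigma3 (W j)) -> sigma3 (fun x => exists j, W j x).
Proof.
move=> sW; pose I j := projT1 (cid (sW j)).
have sI j : exists D : I j -> _, forall x, _ := projT2 (cid (sW j)).
pose D j := projT1 (cid (sI j)).
have DW j x : W j x <-> exists i, infinitely_often (D j i) x := projT2 (cid (sI j)) x.
exists {j : J & I j}, (fun a => D (tag a) (tagged a)) => x; split.
  by move=> [j /DW[i Di]]; exists (Tagged I i).
by move=> [[j i] Di]; exists j; apply/DW; exists i.
Qed.

Lemma omega_regular_sigma3 (V : finType) (L : word V -> Prop) : omega_regular L -> sigma3 L.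
Proof.
move=> [Q [init [delta [acc LP]]]]; have [I [D DP]] := buchi_sigma3 init delta acc.
by exists I, D => x; rewrite LP.
Qed.

(** * Values and Nash equilibria *)

(** Whether [R x y] holds depends on [x] only through [key x], a subset of ['I_K]; the rank counts
    the keys of the words below [x], and totality lets it decide [R]. *)
Lemma recognizable_rank (V : finType) (R : word V -> word V -> Prop) :
  omega_recognizable R -> is_preorder R -> is_total R ->
  exists (rank : word V -> nat) (B : nat),
    (forall x, rank x <= B) /\ (forall x y, R x y <-> rank x <= rank y).
Proof.
move=> [K [X [Y [_ RXY]]]] [Rxx Rtr] Rtot.
pose key x := [set k : 'I_K | `[< X k x >]].
have R_key x x' y : key x = key x' -> R x y -> R x' y.
  move=> e /RXY[k [kK [Xx Yy]]]; apply/RXY; exists k; split=> //; split=> //.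
  have : Ordinal kK \in key x by rewrite inE; apply/asboolP.
  by rewrite e inE => /asboolP.
pose down y := [set c | `[< exists2 z, R z y & key z = c >]].
have down_key x y : (key x \in down y) <-> R x y.
  rewrite inE; split=> [/asboolP[z Rzy e]|Rxy]; first exact: R_key Rzy.
  by apply/asboolP; exists x.
have down_sub x y : R x y -> down x \subset down y.
  move=> Rxy; apply/subsetP => c; rewrite !inE => /asboolP[z Rzx e].
  by apply/asboolP; exists z => //; exact: Rtr Rxy.
exists (fun x => #|down x|), #|{set 'I_K}|; split=> [x|x y]; first exact: max_card.
split=> [/down_sub/subset_leq_card//|le_xy].
have [//|/down_sub syx] := Rtot x y.
have card_eq : #|down y| = #|down x| by apply/anti_leq; rewrite le_xy subset_leq_card.
by apply/down_key; rewrite (subset_cardP card_eq syx); apply/down_key.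
Qed.

Section Arena.
Variables (V P : finType) (E : rel V) (owner : V -> P).
Implicit Types (x y : word V) (sigma : P -> seq V -> V).

Lemma last_prefix (v : V) x n : last v (prefix x n.+1) = x n.
Proof. by rewrite prefixS last_rcons. Qed.

Lemma out_histE sigma v n : out_hist owner sigma v n = prefix (outcome owner sigma v) n.+1.
Proof. by elim: n => // n IH; rewrite prefixS -IH /outcome /= last_rcons. Qed.

Lemma outcomeS sigma v n (x := outcome owner sigma v) :
  x n.+1 = sigma (owner (x n)) (prefix x n.+1).
Proof. by rewrite /x -out_histE {1}/outcome /= last_rcons. Qed.

Lemma outcome_play sigma v : is_profile E owner sigma -> is_play E (outcome owner sigma v).
Proof. by move=> prof n; rewrite outcomeS prefixS; exact: prof. Qed.

Hypothesis serialE : forall v, exists u, E v u.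

Lemma exists_strategy (v0 : V) i : exists s, is_strategy E owner i s.
Proof.
have /choice[s sP] := serialE.
by exists (fun h => s (last v0 h)) => h v _; rewrite last_rcons.
Qed.

Lemma exists_consistent i s v : is_strategy E owner i s -> exists x, consistent E owner i s v x.
Proof.
move=> ls; have /choice[sigma sP] := exists_strategy v.
have prof : is_profile E owner (deviate sigma i s).
  by move=> j; rewrite /deviate; case: eqP => [->|_].
exists (outcome owner (deviate sigma i s) v); split=> //; split; first exact: outcome_play.
by move=> n on; rewrite outcomeS on /deviate eqxx.
Qed.

Variable pref : P -> word V -> word V -> Prop.

Lemma exists_min_consistent i s v (rank : word V -> nat) :
  (forall x y, pref i x y <-> rank x <= rank y) -> is_strategy E owner i s ->
  exists m, min_consistent E owner (pref i) i s v m.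
Proof.
move=> rankP ls; have [x cx] := exists_consistent v ls.
have [|n [m [cm <-]] mmin] := @least_nat (fun n => exists m, consistent E owner i s v m /\ rank m = n).
  by exists (rank x), x.
exists m; split=> // y cy; apply/rankP; rewrite leqNgt; apply/negP => lt_ym.
by apply: (mmin _ lt_ym); exists y.
Qed.

Lemma exists_value i v (rank : word V -> nat) B :
  (forall x, rank x <= B) -> (forall x y, pref i x y <-> rank x <= rank y) ->
  exists w, is_value E owner pref i v w.
Proof.
move=> rankB rankP.
pose secured n := exists s m, [/\ is_strategy E owner i s,
  min_consistent E owner (pref i) i s v m & rank m = n].
have exn : exists n, `[< secured n >].
  have [s ls] := exists_strategy v i; have [m mm] := exists_min_consistent v rankP ls.
  by exists (rank m); apply/asboolP; exists s, m.
have ubn n : `[< secured n >] -> n <= B by move=> /asboolP[s [m [_ _ <-]]].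
case: (ex_maxnP exn ubn) => _ /asboolP[s [w [ls mw <-]]] maxw.
exists w; split.
  by exists s, w; split=> //; split=> //; split; apply/rankP.
by move=> s' m ls' mm; apply/rankP/maxw/asboolP; exists s', m.
Qed.

End Arena.

(** * Prefix-independence and concatenation *)

Section PrefixIndependence.
Variables (V : finType) (R : word V -> word V -> Prop).
Hypotheses (Rpre : is_preorder R) (Rpi : prefix_independent R).

Lemma catw_prefix (x : word V) n : catw (prefix x n) (fun k => x (n + k)) = x.
Proof.
apply: funext => k; rewrite /catw size_prefix; case: ltnP => [kn|nk].
  by rewrite nth_mkseq.
by rewrite subnKC.
Qed.

Lemma catwE (u : seq V) (x : word V) k : catw u x (size u + k) = x k.
Proof. by rewrite /catw ltnNge leq_addr /= addKn. Qed.

Lemma prefix_catw (u : seq V) (x : word V) k :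
  prefix (catw u x) (size u + k) = u ++ prefix x k.
Proof.
elim: k => [|k IH]; last by rewrite addnS !prefixS IH catwE rcons_cat.
rewrite addn0 cats0; apply: (@eq_from_nth _ (x 0)) => [|j]; rewrite size_prefix // => ju.
by rewrite nth_mkseq // /catw ju.
Qed.

Lemma catw0 (x : word V) : catw [::] x = x.
Proof. by apply: funext => k; rewrite /catw /= subn0. Qed.

Lemma catw_equiv (u : seq V) (x : word V) : equiv R x (catw u x).
Proof.
have /Rpi Rxx := proj1 Rpre x.
by split; [have := Rxx [::] u | have := Rxx u [::]]; rewrite catw0.
Qed.

End PrefixIndependence.

Lemma prefix_eq (V : finType) (x y : word V) n :
  (forall k, k < n -> x k = y k) -> prefix x n = prefix y n.
Proof.
elim: n => // n IH e; rewrite !prefixS e // IH // => k kn.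
exact/e/ltnW.
Qed.

Lemma prefix_inj (V : finType) (x y : word V) n k :
  prefix x n = prefix y n -> k < n -> x k = y k.
Proof.
move=> e kn; have ek : rcons (prefix x k) (x k) = rcons (prefix y k) (y k).
  by rewrite -!prefixS -(take_prefix x kn) e take_prefix.
by have [_] := rcons_inj ek.
Qed.

(** * The two directions of the characterization *)

Section NashOutcomes.
Variables (V P : finType) (E : rel V) (owner : V -> P).
Variable pref : P -> word V -> word V -> Prop.
Hypothesis serialE : forall v, exists u, E v u.
Hypothesis recog : forall i, omega_recognizable (pref i).
Hypothesis preo : forall i, is_preorder (pref i).
Hypothesis tot : forall i, is_total (pref i).
Hypothesis pi : forall i, prefix_independent (pref i).
Variable rho : word V.
Hypothesis play_rho : is_play E rho.

(** With [rho] fixed on the right, recognizability leaves the finite union of those [X k] for which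
    [rho] is in [Y k]. *)
Lemma sigma3_below i : sigma3 (fun x => pref i x rho).
Proof.
have [K [X [Y [reg prefE]]]] := recog i.
have [|I [D DP]] := @sigma3_bigcup V {k : 'I_K | `[< Y k rho >]} (fun k => X (val (val k))).
  by move=> k; apply: omega_regular_sigma3; case: (reg _ (ltn_ord (val k))).
exists I, D => x; rewrite -DP prefE; split=> [[k [kK [Xk /asboolP Yk]]]|[k Xk]].
  by exists (exist (fun k : 'I_K => `[< Y k rho >]) (Ordinal kK) Yk).
by exists (val (val k)); split; [exact: ltn_ord | split=> //]; exact/asboolP/(valP k).
Qed.

Lemma nash_outcome_value sigma : nash_eq E owner pref sigma (rho 0) ->
  (forall n, outcome owner sigma (rho 0) n = rho n) ->
  forall n i, owner (rho n) = i -> forall w, is_value E owner pref i (rho n) w -> pref i w rho.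
Proof.
move=> [prof ne] /funext out n i on w [[s [m [ls [[_ mmin] [_ Rwm]]]]] _].
have [_ tr] := preo i.
have [//|nRw] := pselect (pref i w rho).
(* Histories of length at most [n] end before [rho n], so [i] leaves [sigma] with the move out of
   [rho n]; dropping [n] vertices gives [s] a history that starts there. *)
pose tau h := if size h <= n then sigma i h else s (drop n h).
have ltau : is_strategy E owner i tau.
  move=> h v ov; rewrite /tau size_rcons; case: ltnP => hn; first exact: prof.
  by rewrite drop_rcons //; exact: ls.
set x := outcome owner (deviate sigma i tau) (rho 0).
have devP : is_profile E owner (deviate sigma i tau).
  by move=> j; rewrite /deviate; case: eqP => [->|_].
have x_rho k : k <= n -> prefix x k.+1 = prefix rho k.+1.
  elim: k => [//|k IH] kn; have e := IH (ltnW kn).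
  rewrite prefixS [in RHS]prefixS e; congr rcons.
  rewrite /x outcomeS -/x e (prefix_inj e (ltnSn k)) /deviate -out.
  by rewrite outcomeS; case: eqP => // ->; rewrite /tau size_prefix kn.
pose y k := x (n + k).
have cy : consistent E owner i s (rho n) y.
  split; first by rewrite /y addn0; exact: prefix_inj (x_rho n (leqnn n)) (ltnSn n).
  split=> [k|k oy]; first by rewrite /y addnS; exact: outcome_play.
  rewrite /y addnS /x outcomeS -/x [owner _]oy /deviate eqxx /tau size_prefix.
  rewrite ltnNge leq_addr /= -addnS.
  have := prefix_catw (prefix x n) y k.+1; rewrite catw_prefix size_prefix => ->.
  by rewrite drop_size_cat ?size_prefix.
have [Ryx _] := catw_equiv (preo i) (pi i) (prefix x n) y.
rewrite catw_prefix in Ryx.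
have Rwx : pref i w x by apply: tr Rwm (tr _ _ _ (mmin y cy) Ryx).
have Rrw : pref i rho w by case: (tot i rho w).
case: (ne i tau ltau); rewrite out; split; first exact: tr Rrw Rwx.
by move=> Rxr; apply: nRw; exact: tr Rwx Rxr.
Qed.

(** Determinacy is applied to the coalition of all players but [i], whose objective is to stay at or
    below [rho]; the alternative would give [i] a strategy whose plays all exceed [rho], against the
    bound on the value. *)
Lemma punishing_strategy n i : owner (rho n) = i ->
  (forall w, is_value E owner pref i (rho n) w -> pref i w rho) ->
  exists c : seq V -> V,
    (forall g v, owner v != i -> E v (c (rcons g v))) /\
    forall x, is_play E x -> prefix x n.+1 = prefix rho n.+1 ->
      (forall m, n <= m -> owner (x m) != i -> x m.+1 = c (prefix x m.+1)) ->
      pref i x rho.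
Proof.
move=> on valP.
have [_ tr] := preo i.
pose own g := owner (last (rho n) g) != i.
pose mv g v : Prop := E (last (rho n) g) v.
have smv : serial mv by move=> g; exact: serialE.
have playE x : play mv (prefix rho n.+1) x <->
    prefix x n.+1 = prefix rho n.+1 /\ forall k, n <= k -> E (x k) (x k.+1).
  rewrite /play size_prefix; split=> -[e p]; split=> //.
    by move=> k nk; have := p k.+1 nk; rewrite /mv last_prefix.
  by case=> // k nk; rewrite /mv last_prefix; exact: p.
have [[c [lc wc]]|[t [lt wt]]] := sigma3_determined own (prefix rho n.+1) smv (sigma3_below i).
  exists c; split=> [g v ov|x px e fx].
    by have := lc (rcons g v); rewrite /own /mv last_rcons; apply.
  apply: wc; first by apply/playE.
  move=> [|m]; rewrite size_prefix // => nm; rewrite /own last_prefix => om.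
  exact: fx.
(* Prepending [prefix rho n] to histories turns [t] into a strategy from [rho n]. Its worst play [m]
   is at most the value, hence at most [rho], which [t] excludes. *)
pose s g := t (prefix rho n ++ g).
have ls : is_strategy E owner i s.
  move=> h v ov; have := lt (prefix rho n ++ rcons h v).
  by rewrite /own /mv /= last_cat last_rcons ov eqxx; apply.
have [rank [B [rankB rankP]]] := recognizable_rank (recog i) (preo i) (tot i).
have [w val_w] := exists_value owner serialE (rho n) rankB rankP.
have [m mm] := exists_min_consistent serialE (rho n) rankP ls.
have Rmr : pref i m rho by exact: tr (proj2 val_w s m ls mm) (valP w val_w).
have [[m0 [pm fm]] _] := mm.
pose x := catw (prefix rho n) m.
have xE k : x (n + k) = m k by rewrite /x -{2}(size_prefix rho n) catwE.
have px k : prefix x (n + k) = prefix rho n ++ prefix m k.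
  by rewrite /x -{2}(size_prefix rho n) prefix_catw.
case: (wt x).
- apply/playE; split=> [|k nk].
    by rewrite -{1}addn1 px [RHS]prefixS -m0 -cats1.
  by rewrite -(subnKC nk) -addnS !xE.
- move=> [|k]; rewrite size_prefix // ltnS => nk.
  rewrite /= negbK last_prefix -(subnKC nk) -addnS !xE px => /eqP ok.
  exact: fm.
- by have [_ Rxm] := catw_equiv (preo i) (pi i) (prefix rho n) m; exact: tr Rxm Rmr.
Qed.

Lemma value_nash_outcome :
  (forall n i, owner (rho n) = i -> forall w, is_value E owner pref i (rho n) w -> pref i w rho) ->
  exists sigma, nash_eq E owner pref sigma (rho 0) /\
    forall n, outcome owner sigma (rho 0) n = rho n.
Proof.
move=> val_le.
have /choice[c cP] n := punishing_strategy (erefl _) (val_le n _ (erefl _)).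
(* One function [F] of the history serves all players: it continues [rho], and once [h] has left
   [rho] right after index [k], it plays [c k] at vertices not belonging to the owner of [rho k].
   Elsewhere any successor will do. *)
have /choice[F FP] h : exists u, [/\ forall g v, h = rcons g v -> E v u,
    h = prefix rho (size h) -> u = rho (size h) &
    forall k, k.+1 < size h -> take k.+1 h = prefix rho k.+1 ->
      take k.+2 h <> prefix rho k.+2 ->
      forall g v, h = rcons g v -> owner v != owner (rho k) -> u = c k h].
  have [e|ne] := pselect (h = prefix rho (size h)).
    exists (rho (size h)); split=> // [g v|k kh _].
      move=> eh; move: e; rewrite eh size_rcons prefixS => /rcons_inj[_ ->].
      exact: play_rho.
    by rewrite e take_prefix // => /(_ erefl).
  have [[k [g [v [[kh tk ntk] eh ov]]]]|no] := pselect (exists k g v,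
      [/\ [/\ k.+1 < size h, take k.+1 h = prefix rho k.+1 & take k.+2 h <> prefix rho k.+2],
        h = rcons g v & owner v != owner (rho k)]).
    exists (c k h); split=> // [g' v' eh'|k' kh' tk' ntk' _ _ _ _].
      have [_ <-] : (g, v) = (g', v') by apply/rcons_inj; rewrite -eh.
      by rewrite eh; have [lc _] := cP k; exact: lc.
    case: (ltngtP k k') => [lt_kk'|lt_kk'|->//].
      by case: ntk; rewrite -(take_takel h (lt_kk' : k.+2 <= k'.+1)) tk' take_prefix.
    by case: ntk'; rewrite -(take_takel h (lt_kk' : k'.+2 <= k.+1)) tk take_prefix.
  have [u Eu] := serialE (last (rho 0) h).
  exists u; split=> // [g v eh|k kh tk ntk g v eh ov]; first by rewrite eh last_rcons in Eu.
  by case: no; exists k, g, v.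
have FE h v : E v (F (rcons h v)) by have [+ _ _] := FP (rcons h v); apply.
have Frho n : F (prefix rho n) = rho n.
  by have [_ + _] := FP (prefix rho n); rewrite size_prefix => ->.
pose sigma (_ : P) := F.
have prof : is_profile E owner sigma by move=> i h v _; exact: FE.
have out : outcome owner sigma (rho 0) = rho.
  apply: funext => n; have : prefix (outcome owner sigma (rho 0)) n.+1 = prefix rho n.+1.
    elim: n => // n IH; rewrite prefixS [in RHS]prefixS IH; congr rcons.
    by rewrite outcomeS IH; exact: Frho.
  by move/prefix_inj; apply.
exists sigma; split; last by move=> n; rewrite out.
split=> // i tau ltau; rewrite out; set x := outcome _ _ _ => -[Rrx]; apply.
have devP : is_profile E owner (deviate sigma i tau).
  by move=> j; rewrite /deviate; case: eqP => [->|_].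
have px : is_play E x by exact: outcome_play.
have [/least_nat[k xk mink]|e] := pselect (exists k, x k <> rho k); last first.
  rewrite (_ : x = rho); first by case: (preo i).
  by apply: funext => k; apply: contrapT => xk; apply: e; exists k.
case: k => [|k] in xk mink *; first by case: xk.
have ek : prefix x k.+1 = prefix rho k.+1.
  by apply: prefix_eq => j /mink /contrapT.
have xS n : owner (x n) != i -> x n.+1 = F (prefix x n.+1).
  by move=> on; rewrite /x outcomeS -/x /deviate (negbTE on).
(* The first departure is due to [i], since everyone else follows [F], which continues [rho]. *)
have ok : owner (rho k) = i.
  rewrite -(prefix_inj ek (ltnSn k)); apply/eqP; apply: contrapT => /negP /xS.
  by rewrite ek Frho.
have [_] := cP k; rewrite ok; apply=> // m km om.
(* At [m = k] the mover is [i], so only later histories, which have already left [rho], call for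
   punishment. *)
have {}km : k < m.
  by rewrite ltn_neqAle km andbT; apply/eqP => e; rewrite -e (prefix_inj ek) ?ok ?eqxx in om.
rewrite (xS _ om); have [_ _ /(_ k)] := FP (prefix x m.+1).
rewrite size_prefix ltnS !take_prefix ?ltnS ?(ltnW km) //.
apply=> //; [|exact: prefixS|by rewrite ok].
by move/prefix_inj => /(_ k.+1 (ltnSn _)).
Qed.

End NashOutcomes.

Theorem theorem13 (V P : finType) (E : rel V) (owner : V -> P)
  (pref : P -> word V -> word V -> Prop) :
  (forall v : V, exists u : V, E v u) ->
  (forall i : P, omega_recognizable (pref i)) ->
  (forall i : P, is_preorder (pref i)) ->
  (forall i : P, is_total (pref i)) ->
  (forall i : P, prefix_independent (pref i)) ->
  forall rho : word V, is_play E rho ->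
  ((exists sigma : P -> seq V -> V,
       nash_eq E owner pref sigma (rho 0) /\
       forall n, outcome owner sigma (rho 0) n = rho n)
   <->
   (forall (n : nat) (i : P), owner (rho n) = i ->
      forall w : word V, is_value E owner pref i (rho n) w -> pref i w rho)).
Proof.
move=> serialE recog preo tot pi rho play_rho; split=> [[sigma [ne out]]|val_le].
  exact: nash_outcome_value ne out.
exact: value_nash_outcome.
Qed.
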